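(* Let $K$ be a commutative unital ring, $S$ an inverse monoid, and $\theta$ a compatible unital action of $S$ on a unital associative $K$-algebra $A$. For $g\in\mathcal G(S)$ put $\mathcal D_g=\sum_{s\in g}1_sA$ and let $\tilde\theta_g:\mathcal D_{g^{-1}}\to\mathcal D_g$ be given by $$\tilde\theta_g\Big(\sum_{s\in g}a_{s^{-1}}\Big)=\sum_{s\in g}\theta_s(a_{s^{-1}}),\qquad a_{s^{-1}}\in 1_{s^{-1}}A.$$ Then the family $\{\tilde\theta_g\}_{g\in\mathcal G(S)}$ is a partial action of $\mathcal G(S)$ on $A$.
   Context: Inverse monoids. For an inverse monoid $S$, $E(S)$ is its set of idempotents and $s\le t$ means $s=et$ for some $e\in E(S)$. The minimum group congruence $\sigma$ on $S$ is: $(s,t)\in\sigma$ iff there is $u\in S$ with $u\le s$ and $u\le t$. $\mathcal G(S)=S/\sigma$ is the maximum group image of $S$; an element $g\in\mathcal G(S)$ is a $\sigma$-class, i.e. a subset of $S$. Actions. $\mathcal I(A)$ is the symmetric inverse monoid of all bijections between subsets of $A$. A unital action of $S$ on $A$ is a semigroup homomorphism $\theta:S\to\mathcal I(A)$, $s\mapsto\theta_s$, such that the domain and range of each $\theta_s$ are ideals of $A$, $\theta_s$ is an isomorphism of $K$-algebras from its domain onto its range, $\theta_{1_S}=\mathrm{id}_A$, and the range of $\theta_s$ is $1_sA$ for some central idempotent $1_s$ of $A$ (so $\theta_s:1_{s^{-1}}A\to 1_sA$). The action is compatible if for all $(s,t)\in\sigma$ the maps $\theta_s$ and $\theta_t$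 agree on the intersection of their domains. In the definition of $\tilde\theta_g$, sums have finitely many nonzero terms; the formula gives a well-defined bijection $\mathcal D_{g^{-1}}\to\mathcal D_g$. Partial actions. A partial action of a group $G$ on $A$ is a collection of algebra isomorphisms $\theta_x:D_{x^{-1}}\to D_x$ ($x\in G$), where each $D_x$ is an ideal of $A$, such that for all $x,y\in G$: (i) $D_1=A$ and $\theta_1=\mathrm{id}_A$; (ii) $\theta_x(D_{x^{-1}}\cap D_y)=D_x\cap D_{xy}$; (iii) $\theta_x\circ\theta_y=\theta_{xy}$ on $D_{y^{-1}}\cap D_{y^{-1}x^{-1}}$. *)

(* Defs.v *)
From HB Require Import structures.
From mathcomp Require Import all_boot all_algebra.
From mathcomp Require Import generic_quotient.
From mathcomp Require Import boolp classical_sets functions cardinality fsbigop.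

Set Implicit Arguments.
Unset Strict Implicit.
Unset Printing Implicit Defensive.

Import GRing.Theory.

Local Open Scope classical_set_scope.
Local Open Scope ring_scope.

(* Unital associative algebras over a commutative unital ring. Every algType is
   one, but algType imposes 1 != 0, which would exclude the zero algebra; the
   hierarchy has no join of pzRingType and lmodType to build upon, hence the
   explicit scaling operation. *)
HB.mixin Record PzRing_isPzAlgebra (K : comPzRingType) A of GRing.PzRing A := {
  pzscale : K -> A -> A;
  pzscalerA : forall k l a, pzscale k (pzscale l a) = pzscale (k * l) a;
  pzscale1r : forall a, pzscale 1 a = a;
  pzscalerDr : forall k a b, pzscale k (a + b) = pzscale k a + pzscale k b;
  pzscalerDl : forall k l a, pzscale (k + l) a = pzscale k a + pzscale l a;
  pzscalerAl : forall k a b, pzscale k (a * b) = pzscale k a * b;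
  pzscalerAr : forall k a b, pzscale k (a * b) = a * pzscale k b
}.
#[short(type="pzAlgType")]
HB.structure Definition PzAlgebra (K : comPzRingType) :=
  {A of PzRing_isPzAlgebra K A & GRing.PzRing A}.

#[non_forgetful_inheritance]
HB.instance Definition _ (K : comPzRingType) (A : algType K) :=
  PzRing_isPzAlgebra.Build K A (@scalerA K A) (@scale1r K A) (@scalerDr K A)
    (fun k l a => @scalerDl K A a k l) (@scalerAl K A) (@scalerAr K A).

HB.mixin Record StarMonoid_isInverseMonoid S of StarMonoid S := {
  mulgVK : forall s : S, (s * s^-1 * s)%g = s;
  invg_uniq : forall s t : S,
    (s * t * s)%g = s -> (t * s * t)%g = t -> t = s^-1%g
}.
#[short(type="inverseMonoidType")]
HB.structure Definition InverseMonoid :=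
  {S of StarMonoid_isInverseMonoid S & StarMonoid S}.

Definition idempotents (S : monoidType) : set S := [set e | (e * e)%g = e].

Section UniqueInverse.
Variables (S : monoidType) (inv : S -> S).
Local Open Scope group_scope.
Hypothesis mulVK : forall s, s * inv s * s = s.
Hypothesis mulKV : forall s, inv s * s * inv s = inv s.
Hypothesis inv_uniq : forall s t, s * t * s = s -> t * s * t = t -> t = inv s.
Implicit Types s t e f : S.

Lemma unique_inv_idem e : idempotents e -> e = inv e.
Proof. by move=> ee; apply: inv_uniq; rewrite !ee. Qed.

Lemma unique_inv_idemM e f :
  idempotents e -> idempotents f -> idempotents (e * f).
Proof.
rewrite /idempotents /= => ee ff; set x := inv (e * f).
have xef : x * e * f * x = x by rewrite -(mulgA x e f) mulKV.
have xE : f * x * e = x.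
  apply: inv_uniq.
    rewrite !mulgA -(mulgA e f f) ff -(mulgA (e * f * x) e e) ee.
    by rewrite -(mulgA _ e f) mulVK.
  rewrite !mulgA -(mulgA _ e e) ee -(mulgA _ f f) ff.
  by rewrite -!mulgA; congr (f * _); rewrite !mulgA xef.
have xx : x * x = x.
  rewrite -[in LHS]xE !mulgA -[RHS]xE; congr (_ * e).
  by rewrite -!mulgA; congr (f * _); rewrite !mulgA xef.
suff -> : e * f = x by [].
by rewrite (unique_inv_idem xx); apply: inv_uniq; [exact: mulKV|exact: mulVK].
Qed.

Lemma unique_inv_idemC e f : idempotents e -> idempotents f -> e * f = f * e.
Proof.
move=> ee ff.
have ef := unique_inv_idemM ee ff; have fe := unique_inv_idemM ff ee.
rewrite /idempotents /= in ee ff ef fe.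
rewrite (unique_inv_idem ef); apply/esym/inv_uniq.
  by rewrite !mulgA -(mulgA e f f) ff -(mulgA _ e e) ee -mulgA ef.
by rewrite !mulgA -(mulgA f e e) ee -(mulgA _ f f) ff -mulgA fe.
Qed.

Lemma unique_inv_idemgV s : idempotents (s * inv s).
Proof. by rewrite /idempotents /= mulgA mulVK. Qed.

Lemma unique_inv_idemVg s : idempotents (inv s * s).
Proof. by rewrite /idempotents /= mulgA mulKV. Qed.

Lemma unique_invK : involutive inv.
Proof. by move=> s; apply/esym/inv_uniq. Qed.

Lemma unique_invM : {morph inv : s t / s * t >-> t * s}.
Proof.
move=> s t; apply/esym/inv_uniq.
  rewrite !mulgA -(mulgA s t (inv t)) -(mulgA _ (inv s) s) -(mulgA s (t * _)).
  rewrite (unique_inv_idemC (unique_inv_idemgV t) (unique_inv_idemVg s)).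
  by rewrite !mulgA mulVK -(mulgA s t) -(mulgA s) mulVK.
rewrite !mulgA -(mulgA _ (inv s) s) -(mulgA _ t (inv t)).
rewrite -(mulgA (inv t) (inv s * s)).
rewrite (unique_inv_idemC (unique_inv_idemVg s) (unique_inv_idemgV t)).
by rewrite !mulgA mulKV -(mulgA (inv t) (inv s)) -(mulgA (inv t)) mulKV.
Qed.

End UniqueInverse.

(* An inverse monoid is a monoid in which every element has exactly one
   generalized inverse; the *-monoid axioms are consequences. *)
HB.factory Record Monoid_isInverseMonoid S of Monoid S := {
  inv : S -> S;
  mulgVK : forall s : S, (s * inv s * s)%g = s;
  mulVgK : forall s : S, (inv s * s * inv s)%g = inv s;
  invg_uniq : forall s t : S,
    (s * t * s)%g = s -> (t * s * t)%g = t -> t = inv s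
}.
HB.builders Context S of Monoid_isInverseMonoid S.
HB.instance Definition _ := hasInv.Build S inv.
HB.instance Definition _ := Monoid_isStarMonoid.Build S
  (unique_invK mulgVK mulVgK invg_uniq) (unique_invM mulgVK mulVgK invg_uniq).
HB.instance Definition _ :=
  StarMonoid_isInverseMonoid.Build S mulgVK invg_uniq.
HB.end.

Section MaximumGroupImage.
Variable S : inverseMonoidType.
Implicit Types s t u e f : S.
Local Open Scope group_scope.
Local Open Scope quotient_scope.

Definition natural_le s t : Prop := exists2 e, idempotents e & s = e * t.

Definition min_group_cong s t : Prop :=
  exists u, natural_le u s /\ natural_le u t.

Lemma mulVgK s : s^-1 * s * s^-1 = s^-1.
Proof. by rewrite -{2}[s]invgK mulgVK. Qed.

Lemma idemM e f : idempotents e -> idempotents f -> idempotents (e * f).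
Proof. exact: unique_inv_idemM mulgVK mulVgK (@invg_uniq S) _ _. Qed.

Lemma idemC e f : idempotents e -> idempotents f -> e * f = f * e.
Proof. exact: unique_inv_idemC mulgVK mulVgK (@invg_uniq S) _ _. Qed.

Lemma idem1 : idempotents (1 : S).
Proof. by rewrite /idempotents /= mulg1. Qed.

Lemma idemgV s : idempotents (s * s^-1).
Proof. by rewrite /idempotents /= mulgA mulgVK. Qed.

Lemma idemVg s : idempotents (s^-1 * s).
Proof. by rewrite /idempotents /= mulgA mulVgK. Qed.

Lemma idemJ s e : idempotents e -> idempotents (s * e * s^-1).
Proof.
move=> ee; rewrite /idempotents /= !mulgA -(mulgA _ s^-1 s) -(mulgA s e (_ * s)).
by rewrite (idemC ee (idemVg s)) !mulgA mulgVK -(mulgA _ e e) ee.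
Qed.

Lemma natural_le_refl s : natural_le s s.
Proof. by exists 1; [exact: idem1 | rewrite mul1g]. Qed.

Lemma natural_leM s s' t t' :
  natural_le s s' -> natural_le t t' -> natural_le (s * t) (s' * t').
Proof.
move=> [e ee ->] [f ff ->]; exists (e * (s' * f * s'^-1)).
  by apply: idemM => //; exact: idemJ.
rewrite !mulgA -(mulgA _ s'^-1 s') -(mulgA (e * s') f (_ * s')).
by rewrite (idemC ff (idemVg s')) !mulgA -(mulgA e s' s'^-1) -(mulgA e (_ / _)) mulgVK.
Qed.

Lemma min_group_cong_refl : reflexive (fun s t => `[< min_group_cong s t >]).
Proof. by move=> s; apply/asboolP; exists s; split; exact: natural_le_refl. Qed.

Lemma min_group_cong_sym : symmetric (fun s t => `[< min_group_cong s t >]).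
Proof. by move=> s t; apply/asboolP/asboolP => -[u [us ut]]; exists u. Qed.

Lemma min_group_cong_trans : transitive (fun s t => `[< min_group_cong s t >]).
Proof.
move=> t s r /asboolP[u [us [e ee ut]]] /asboolP[v [[f ff vt] vr]].
apply/asboolP; exists (e * f * t); split.
  case: us => e' ee' us; exists (f * e'); first exact: idemM.
  by rewrite (idemC ee ff) -mulgA -ut us mulgA.
case: vr => f' ff' vr; exists (e * f'); first exact: idemM.
by rewrite -mulgA -vt vr mulgA.
Qed.

Lemma min_group_congM s s' t t' : min_group_cong s s' -> min_group_cong t t' ->
  min_group_cong (s * t) (s' * t').
Proof.
move=> [u [us us']] [v [vt vt']].
by exists (u * v); split; exact: natural_leM.
Qed.

Lemma min_group_cong_idem e : idempotents e -> min_group_cong e 1.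
Proof. by move=> ee; exists e; split; exists e; rewrite ?mulg1. Qed.

Definition min_group_equiv :=
  EquivRel (fun s t => `[< min_group_cong s t >])
    min_group_cong_refl min_group_cong_sym min_group_cong_trans.

Definition max_group_image : Type := {eq_quot min_group_equiv}.

HB.instance Definition _ := Choice.on max_group_image.
HB.instance Definition _ := EqQuotient.on max_group_image.

Local Notation G := max_group_image.

Lemma pi_eqP s t : \pi_G s = \pi_G t <-> min_group_cong s t.
Proof.
split=> [/eqmodP /asboolP //|st].
by apply/eqmodP/asboolP.
Qed.

Definition mgi_mul (g h : G) : G := \pi_G (repr g * repr h).
Definition mgi_inv (g : G) : G := \pi_G (repr g)^-1.
Definition mgi_one : G := \pi_G 1.

Lemma pi_mgi_mul s t : mgi_mul (\pi_G s) (\pi_G t) = \pi_G (s * t).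
Proof.
apply/pi_eqP; apply: min_group_congM.
  by apply/pi_eqP; rewrite reprK.
by apply/pi_eqP; rewrite reprK.
Qed.

Lemma mgi_mulA : associative mgi_mul.
Proof.
move=> g h k; rewrite -[g]reprK -[h]reprK -[k]reprK.
rewrite (pi_mgi_mul (repr h) (repr k)) (pi_mgi_mul (repr g) (repr h)).
by rewrite !pi_mgi_mul mulgA.
Qed.

Lemma mgi_mul1 : left_id mgi_one mgi_mul.
Proof. by move=> g; rewrite -[g]reprK pi_mgi_mul mul1g. Qed.

Lemma mgi_1mul : right_id mgi_one mgi_mul.
Proof. by move=> g; rewrite -[g]reprK pi_mgi_mul mulg1. Qed.

Lemma mgi_mulV : left_inverse mgi_one mgi_inv mgi_mul.
Proof.
move=> g; rewrite /mgi_inv -{2}[g]reprK pi_mgi_mul; apply/pi_eqP.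
exact/min_group_cong_idem/idemVg.
Qed.

Lemma mgi_Vmul : right_inverse mgi_one mgi_inv mgi_mul.
Proof.
move=> g; rewrite /mgi_inv -{1}[g]reprK pi_mgi_mul; apply/pi_eqP.
exact/min_group_cong_idem/idemgV.
Qed.

HB.instance Definition _ :=
  isGroup.Build G mgi_mulA mgi_mul1 mgi_1mul mgi_mulV mgi_Vmul.

(* The element g of the maximum group image, viewed as a subset of S. *)
Definition sigma_class (g : G) : set S := [set s | \pi_G s = g].

End MaximumGroupImage.

Section SymmetricInverseMonoid.
Variable A : Type.

Definition pdom (f : A -> option A) : set A := [set x | exists y, f x = Some y].
Definition prange (f : A -> option A) : set A :=
  [set y | exists x, f x = Some y].
Definition pinjective (f : A -> option A) : Prop :=
  forall x y z, f x = Some z -> f y = Some z -> x = y.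

(* A bijection between two subsets of A is an injective partial self-map of A,
   None standing for an undefined value. *)
Record sym_inv_monoid : Type :=
  SymInv { pbij_fun :> A -> option A; pbij_inj : pinjective pbij_fun }.

Local Notation IA := sym_inv_monoid.

Lemma pbij_eq (f g : IA) : f =1 g -> f = g.
Proof.
case: f g => [f fi] [g gi] /= /funext fg; case: _ / fg in gi *.
by rewrite (Prop_irrelevance fi gi).
Qed.

Lemma pcomp_subproof (f g : IA) : pinjective (fun x => obind f (g x)).
Proof.
move=> x y z /=; case gx: (g x) => [u|//] /= fu; case gy: (g y) => [v|//] /= fv.
by rewrite (pbij_inj fu fv) in gx; exact: pbij_inj gx gy.
Qed.

Definition pcomp (f g : IA) : IA := SymInv (@pcomp_subproof f g).

Lemma pid_subproof : pinjective (@Some A).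
Proof. by move=> x y z [->] [->]. Qed.

Definition pid : IA := SymInv pid_subproof.

Lemma pcompA : associative pcomp.
Proof. by move=> f g h; apply: pbij_eq => x /=; case: (h x). Qed.

Lemma pcomp1f : left_id pid pcomp.
Proof. by move=> f; apply: pbij_eq => x /=; case: (f x). Qed.

Lemma pcompf1 : right_id pid pcomp.
Proof. by move=> f; apply: pbij_eq. Qed.

HB.instance Definition _ := gen_eqMixin IA.
HB.instance Definition _ := gen_choiceMixin IA.
HB.instance Definition _ := isMonoid.Build IA pcompA pcomp1f pcompf1.

End SymmetricInverseMonoid.

Section Actions.
Variables (K : comPzRingType) (A : pzAlgType K).

Definition is_ideal (I : set A) : Prop :=
  [/\ I 0, (forall x y, I x -> I y -> I (x + y)),
      (forall (k : K) x, I x -> I (pzscale k x)) &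
      (forall a x, I x -> I (a * x) /\ I (x * a))].

Definition is_alg_iso (I J : set A) (f : A -> option A) : Prop :=
  [/\ pdom f = I /\ prange f = J, pinjective f,
      (forall x y x' y', f x = Some x' -> f y = Some y' ->
         f (x + y) = Some (x' + y')),
      (forall (k : K) x x', f x = Some x' -> f (pzscale k x) = Some (pzscale k x')) &
      (forall x y x' y', f x = Some x' -> f y = Some y' ->
         f (x * y) = Some (x' * y'))].

Definition principal (e : A) : set A := [set x | exists a, x = e * a].

Record unital_action (S : inverseMonoidType) := UnitalAction {
  action :> {multiplicative S -> sym_inv_monoid A};
  action_unit : S -> A;
  action_ideal : forall s,
    is_ideal (pdom (action s)) /\ is_ideal (prange (action s));
  action_iso : forall s,
    is_alg_iso (pdom (action s)) (prange (action s)) (action s);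
  action_id : action 1%g = pid A;
  action_unit_central : forall s a, action_unit s * a = a * action_unit s;
  action_unit_idem : forall s, action_unit s * action_unit s = action_unit s;
  action_range : forall s, prange (action s) = principal (action_unit s)
}.

Definition compatible (S : inverseMonoidType) (th : unital_action S) : Prop :=
  forall s t : S, min_group_cong s t ->
  forall a b c : A, th s a = Some b -> th t a = Some c -> b = c.

Record is_partial_action (G : groupType) (D : G -> set A)
    (th : G -> A -> option A) : Prop := IsPartialAction {
  partial_action_ideal : forall x, is_ideal (D x);
  partial_action_iso : forall x, is_alg_iso (D x^-1%g) (D x) (th x);
  partial_action_one : D 1%g = setT /\ (forall a, th 1%g a = Some a);
  partial_action_image : forall x y,
    [set b | exists2 a, (D x^-1%g `&` D y) a & th x a = Some b]
    = D x `&` D (x * y)%g;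
  partial_action_comp : forall x y a,
    (D y^-1%g `&` D (y^-1 * x^-1)%g) a ->
    obind (th x) (th y a) = th (x * y)%g a
}.

Section InducedPartialAction.
Variables (S : inverseMonoidType) (th : unital_action S).
Local Notation G := (max_group_image S).
Implicit Types (g : G) (a b : S -> A).

Definition finite_family g a : Prop :=
  finite_set (sigma_class g `&` a @^-1` [set~ 0]).

Definition induced_dom g : set A :=
  [set x | exists a,
    [/\ (forall s, sigma_class g s -> principal (action_unit th s) (a s)),
        finite_family g a & x = \sum_(s \in sigma_class g) a s]].

(* a s stands for a_{s^-1}, the summand lying in 1_{s^-1} A. *)
Definition source_family g a : Prop :=
  (forall s, sigma_class g s -> principal (action_unit th s^-1%g) (a s))
  /\ finite_family g a.

Definition action_fun (s : S) (x : A) : A := odflt 0 (th s x).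

Definition induced_graph g (x y : A) : Prop :=
  exists2 a, source_family g a &
    x = \sum_(s \in sigma_class g) a s /\
    y = \sum_(s \in sigma_class g) action_fun s (a s).

(* For a compatible action the choice of the value is immaterial, see
   induced_mapE below. *)
Definition induced_map g (x : A) : option A :=
  if pselect (exists y, induced_graph g x y) is left ex_y
  then Some (sval (cid ex_y)) else None.

Lemma action_dom s : pdom (th s) = principal (action_unit th s^-1%g).
Proof.
rewrite -action_range; apply/seteqP; split=> x /= [y].
  move=> sx; have : th (s * s^-1 * s)%g x = th s x by rewrite mulgVK.
  rewrite !gmulfM /= sx /=; case sy: (th s^-1%g y) => [z|//] /= sz.
  by exists y; rewrite sy (pbij_inj sz sx).
move=> sx; have : th (s^-1 * s * s^-1)%g y = th s^-1%g y by rewrite mulVgK.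
by rewrite !gmulfM /= sx /=; case sy: (th s x) => [z|//] _; exists z.
Qed.

Lemma principal_idE s x : principal (action_unit th s) x ->
  action_unit th s * x = x.
Proof. by move=> [a ->]; rewrite mulrA action_unit_idem. Qed.

Lemma action_funE s x : principal (action_unit th s^-1%g) x ->
  th s x = Some (action_fun s x).
Proof. by rewrite -action_dom /action_fun => -[y ->]. Qed.

Lemma action_funD s x y : principal (action_unit th s^-1%g) x ->
  principal (action_unit th s^-1%g) y ->
  action_fun s (x + y) = action_fun s x + action_fun s y.
Proof.
move=> /action_funE sx /action_funE sy; have [_ _ sD _ _] := action_iso th s.
by rewrite {1}/action_fun (sD _ _ _ _ sx sy).
Qed.

Lemma action_fun0 s : action_fun s 0 = 0.
Proof.
have s0 : principal (action_unit th s^-1%g) 0 by exists 0; rewrite mulr0.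
apply: (addrI (action_fun s 0)); rewrite addr0 -action_funD //.
by rewrite addr0.
Qed.

Hypothesis th_compat : compatible th.

Lemma action_fun_glue g (r : seq S) :
  (forall s, s \in r -> sigma_class g s) ->
  exists2 F : A -> A, {morph F : x y / x + y} &
    forall s, s \in r -> forall x, principal (action_unit th s^-1%g) x ->
      F x = action_fun s x.
Proof.
elim: r => [|s r IHr] rg; first by exists (fun=> 0) => // x y; rewrite addr0.
have [t tr|F FD FE] := IHr; first by apply: rg; rewrite inE tr orbT.
have F0 : F 0 = 0.
  by apply: (addrI (F 0)); rewrite addr0 -FD addr0.
pose e := action_unit th s^-1%g.
exists (fun x => action_fun s (e * x) + F (x - e * x)) => [x y|t].
  rewrite mulrDr action_funD; [|by exists x|by exists y].
  by rewrite opprD addrACA FD addrACA.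
rewrite inE => /predU1P[->{t}|tr] x px.
  by rewrite (principal_idE px) subrr F0 addr0.
have pt y : principal (action_unit th t^-1%g) (y * x).
  case: px => z ->; exists (y * z).
  by rewrite !mulrA action_unit_central.
have px' : principal (action_unit th t^-1%g) (x - e * x).
  by rewrite -{1}(mul1r x) -mulrBl.
rewrite (FE t) //.
have -> : action_fun s (e * x) = action_fun t (e * x).
  have st : min_group_cong s t.
    apply/pi_eqP; rewrite (rg s) ?mem_head //.
    by rewrite (rg t) // inE tr orbT.
  apply: (th_compat st (a := e * x)); apply: action_funE => //.
  by exists x.
by rewrite -action_funD // addrC subrK.
Qed.

Lemma fsum_seqE g (f : S -> A) (r : seq S) : uniq r ->
  (forall s, s \in r -> sigma_class g s) ->
  (forall s, sigma_class g s -> s \notin r -> f s = 0) ->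
  \sum_(s \in sigma_class g) f s = \sum_(s <- r) f s.
Proof.
move=> ur rg f0; rewrite [RHS]fsbig_seq //.
apply/esym/fsbig_widen => [s /= /rg //|s /= [gs /negP rs]].
exact: f0.
Qed.

Lemma induced_graph_fun g x y z :
  induced_graph g x y -> induced_graph g x z -> y = z.
Proof.
move=> [a [pa fa] [-> ->]] [b [pb fb] [+ ->]].
pose X := (sigma_class g `&` a @^-1` [set~ 0])
          `|` (sigma_class g `&` b @^-1` [set~ 0]).
have [r rX] : exists2 r : seq S, uniq r & [set` r] = X.
  have : finite_set X by rewrite finite_setU.
  move=> /finite_fsetP[r ->].
  by exists (finmap.enum_fset r) => //; exact: finmap.fset_uniq.
move=> rE; have rP s : s \in r <-> X s by rewrite -rE.
have rg s : s \in r -> sigma_class g s by move=> /rP[] [].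
have a0 s : sigma_class g s -> s \notin r -> a s = 0.
  by move=> gs /negP sr; apply: contrapT => as0; apply: sr; apply/rP; left.
have b0 s : sigma_class g s -> s \notin r -> b s = 0.
  by move=> gs /negP sr; apply: contrapT => as0; apply: sr; apply/rP; right.
have ta0 s : sigma_class g s -> s \notin r -> action_fun s (a s) = 0.
  by move=> gs sr; rewrite a0 // action_fun0.
have tb0 s : sigma_class g s -> s \notin r -> action_fun s (b s) = 0.
  by move=> gs sr; rewrite b0 // action_fun0.
rewrite (fsum_seqE rX rg a0) (fsum_seqE rX rg b0).
rewrite (fsum_seqE rX rg ta0) (fsum_seqE rX rg tb0).
have [F FD FE] := action_fun_glue rg.
have F0 : F 0 = 0 by apply: (addrI (F 0)); rewrite addr0 -FD addr0.
have Fsum c : (forall s, sigma_class g s ->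
    principal (action_unit th s^-1%g) (c s)) ->
    \sum_(s <- r) action_fun s (c s) = F (\sum_(s <- r) c s).
  move=> pc; rewrite (big_morph F FD F0); apply: eq_big_seq => s sr.
  by rewrite (FE s) //; apply/pc/rg.
by rewrite !Fsum // => ->.
Qed.

Lemma induced_mapE g a : source_family g a ->
  induced_map g (\sum_(s \in sigma_class g) a s) =
  Some (\sum_(s \in sigma_class g) action_fun s (a s)).
Proof.
move=> ga; rewrite /induced_map.
have gr : induced_graph g (\sum_(s \in sigma_class g) a s)
  (\sum_(s \in sigma_class g) action_fun s (a s)) by exists a.
case: pselect => [ex|[]]; last by eexists; exact: gr.
by congr Some; case: (cid ex) => y /= gy; apply: induced_graph_fun gy gr.
Qed.

End InducedPartialAction.
End Actions.

(* Main.v *)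
(* The graph of the induced map at g is the additive relation generated by the
   graphs of the theta_s with s in g, so every closure property is checked on
   these generators: inversion of s yields the graph at g^-1, and multiplicativity
   comes from theta_s and theta_t agreeing on 1_{s^-1} 1_{t^-1}. The axioms on
   composition need an element of D_{g^-1} :&: D_h to be a sum of elements on
   which theta_s and theta_{t^-1}, s in g and t in h, are both defined; this holds
   because ideals generated by central idempotents have local units. *)
Require Import Defs.
From mathcomp Require Import all_boot all_algebra.
From mathcomp Require Import generic_quotient boolp classical_sets cardinality.
From mathcomp Require Import fsbigop.

Set Implicit Arguments.
Unset Strict Implicit.
Unset Printing Implicit Defensive.

Import GRing.Theory.

Local Open Scope classical_set_scope.
Local Open Scope ring_scope.

(** * Products and inverses of sigma-classes *)

Section SigmaClass.
Variable S : inverseMonoidType.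
Local Notation G := (max_group_image S).
Implicit Types (g h : G) (s t : S).

Lemma sigma_classM g h s t :
  sigma_class g s -> sigma_class h t -> sigma_class (g * h)%g (s * t)%g.
Proof. by move=> <- <-; rewrite /sigma_class /= -pi_mgi_mul. Qed.

(** The idempotent $s s^{-1}$ is sigma-related to $1$, so the class of $s^{-1}$ is a group inverse
    of $g$. *)
Lemma sigma_classV g s : sigma_class g s -> sigma_class g^-1%g s^-1%g.
Proof.
move=> gs; apply/esym/mulg1_eq; rewrite -gs [LHS]pi_mgi_mul.
exact/pi_eqP/min_group_cong_idem/idemgV.
Qed.

Lemma sigma_class_cong g s t :
  sigma_class g s -> sigma_class g t -> min_group_cong s t.
Proof. by move=> gs gt; apply/pi_eqP; rewrite gs. Qed.

End SigmaClass.

(** * The partial isomorphisms $\theta_s$ *)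

Section Action.
Variables (K : comPzRingType) (A : pzAlgType K) (S : inverseMonoidType).
Variable th : unital_action A S.
Implicit Types (s t : S) (x y z : A).
Local Notation E := (action_unit th).

Lemma pzscaler0 (k : K) : pzscale k (0 : A) = 0.
Proof. by apply: (addrI (pzscale k 0)); rewrite -pzscalerDr !addr0. Qed.

Lemma action_domP s x : (exists y, th s x = Some y) <-> E s^-1%g * x = x.
Proof.
split=> [sx|ex].
  apply: principal_idE; have : pdom (th s) x by [].
  by rewrite action_dom.
by suff : pdom (th s) x by []; rewrite action_dom; exists x.
Qed.

(** The range of $\theta_s$ is the domain of $\theta_{s^{-1}}$; then
    $\theta_s\theta_{s^{-1}}\theta_s=\theta_s$ and injectivity of $\theta_s$ identify the value. *)
Lemma actionV s x y : th s x = Some y -> th s^-1%g y = Some x.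
Proof.
move=> sx; have [z sy] : exists z, th s^-1%g y = Some z.
  apply/action_domP; rewrite invgK; apply: principal_idE.
  by rewrite -action_range; exists x.
have : th (s * s^-1 * s)%g x = th s x by rewrite Defs.mulgVK.
rewrite !gmulfM /= sx /= sy /= => sz.
by rewrite (pbij_inj sz sx).
Qed.

Lemma actionVK s x y : th s^-1%g y = Some x -> th s x = Some y.
Proof. by move=> /actionV; rewrite invgK. Qed.

Lemma action_ranE s x y : th s x = Some y -> E s * y = y.
Proof.
by move=> /actionV sy; rewrite -[in LHS](invgK s); apply/action_domP; exists x.
Qed.

Lemma actionM s t x y z :
  th t x = Some y -> th s y = Some z -> th (s * t)%g x = Some z.
Proof. by move=> tx sy; rewrite gmulfM /= tx. Qed.

Lemma action_mul s x y x' y' : th s x = Some x' -> th s y = Some y' ->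
  th s (x * y) = Some (x' * y').
Proof. by have [_ _ _ _] := action_iso th s; apply. Qed.

Lemma action_scale s (k : K) x x' :
  th s x = Some x' -> th s (pzscale k x) = Some (pzscale k x').
Proof. by have [_ _ _ + _] := action_iso th s; apply. Qed.

Hypothesis th_compat : compatible th.

(* By compatibility s and t agree on 1_{s^-1} 1_{t^-1}, and so do their
   inverses on 1_s 1_t; hence this value f is the identity of
   1_s A :&: 1_t A. *)
Lemma action_mul_cong s t x y x' y' : min_group_cong s t ->
  min_group_cong s^-1%g t^-1%g -> th s x = Some x' -> th t y = Some y' ->
  th s (x * y) = Some (x' * y').
Proof.
move=> st st' sx ty.
have ex : E s^-1%g * x = x by apply/action_domP; exists x'.
have ey : E t^-1%g * y = y by apply/action_domP; exists y'.
have ex' := action_ranE sx; have ey' := action_ranE ty.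
have Es r := action_unit_idem th r; have Ec r := action_unit_central th r.
pose e := E s^-1%g * E t^-1%g.
have [f sf] : exists f, th s e = Some f.
  by apply/action_domP; rewrite mulrA Es.
have tf : th t e = Some f.
  have [f' tf] : exists f, th t e = Some f.
    by apply/action_domP; rewrite Ec -mulrA Es.
  by rewrite tf (th_compat st sf tf).
(* The element $c$ is a common preimage of $1_s1_t$ under $\theta_s$ and $\theta_t$, hence fixed by
   $e$; applying $\theta_s$ to $ec=c$ shows that $f$ fixes $1_s1_t$. *)
have [c sc] : exists c, th s^-1%g (E s * E t) = Some c.
  by apply/action_domP; rewrite invgK mulrA Es.
have tc : th t^-1%g (E s * E t) = Some c.
  have [c' tc] : exists c, th t^-1%g (E s * E t) = Some c.
    by apply/action_domP; rewrite invgK Ec -mulrA Es.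
  by rewrite tc (th_compat st' sc tc).
have fE : f * (E s * E t) = E s * E t.
  have ec : e * c = c.
    by rewrite -mulrA (action_ranE tc) (action_ranE sc).
  have sc' := actionVK sc.
  by have := action_mul sf sc'; rewrite ec sc' => -[<-].
(* Inserting $e$ and $f$ leaves only $\theta_s(ey)=fy'$ to prove. This holds for $\theta_t$, and
   compatibility transfers it to $\theta_s$. *)
have -> : x * y = x * (e * y).
  by rewrite -mulrA ey mulrA -(Ec _ x) ex.
have -> : x' * y' = x' * (f * y').
  have -> : x' * y' = x' * (E s * E t) * y'.
    by rewrite mulrA -(Ec s x') ex' -mulrA ey'.
  by rewrite -fE (mulrA f) -(Ec s f) (action_ranE sf) -!mulrA ey'.
have tey := action_mul tf ty.
have [w sw] : exists w, th s (e * y) = Some w.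
  by apply/action_domP; rewrite !mulrA Es.
apply: action_mul => //.
by rewrite sw (th_compat st sw tey).
Qed.

(** * Finitely supported sums over a sigma-class *)

Section FiniteFamilies.
Variable g : max_group_image S.
Local Notation X := (sigma_class g).

Lemma finite_family_seq (a : S -> A) : finite_family g a ->
  exists r : seq S, [/\ uniq r, forall s, s \in r -> X s &
    forall s, X s -> s \notin r -> a s = 0].
Proof.
move=> /finite_seqP[r rE]; exists (undup r); split=> [|s|s Xs].
- exact: undup_uniq.
- rewrite mem_undup => rs; suff [] : (X `&` a @^-1` [set~ 0]) s by [].
  by rewrite rE.
- rewrite mem_undup => /negP rs; apply: contrapT => as0; apply: rs.
  suff : [set` r] s by [].
  by rewrite -rE.
Qed.

Lemma finite_family0 : finite_family g (fun=> 0 : A).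
Proof.
rewrite /finite_family (_ : _ `&` _ = set0) //.
by apply/seteqP; split=> // s [_] /=.
Qed.

Lemma finite_familyD (a b : S -> A) : finite_family g a ->
  finite_family g b -> finite_family g (fun s => a s + b s).
Proof.
move=> fa fb; have : finite_set
    ((X `&` a @^-1` [set~ 0]) `|` (X `&` b @^-1` [set~ 0])).
  by rewrite finite_setU.
apply: sub_finite_set => s [/= Xs ab0].
have [as0|as0] := pselect (a s = 0); [right|by left].
by split=> // bs0; apply: ab0; rewrite as0 bs0 addr0.
Qed.

Lemma sub_finite_family (a b : S -> A) :
  (forall s, X s -> a s = 0 -> b s = 0) ->
  finite_family g a -> finite_family g b.
Proof.
move=> ab; apply: sub_finite_set => s [/= Xs bs0]; split=> // as0.
exact/bs0/ab.
Qed.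

(** The support of [b] lies in that of [a], so both sums run over one finite list, along which the
    additive relation [P] accumulates. *)
Lemma fsum_family_ind (P : A -> A -> Prop) (a b : S -> A) :
  finite_family g a -> (forall s, X s -> a s = 0 -> b s = 0) ->
  P 0 0 ->
  (forall x y x' y', P x y -> P x' y' -> P (x + x') (y + y')) ->
  (forall s, X s -> P (a s) (b s)) ->
  P (\sum_(s \in X) a s) (\sum_(s \in X) b s).
Proof.
move=> fa ab P0 PD Pab; have [r [ur rX a0]] := finite_family_seq fa.
rewrite (fsum_seqE ur rX a0) (fsum_seqE (f := b) ur rX); last first.
  by move=> s Xs sr; apply: ab => //; exact: a0.
rewrite [X in P X _]big_seq [X in P _ X]big_seq.
by apply: (big_ind2 P) => // s /rX /Pab.
Qed.

Lemma fsum_familyD (a b : S -> A) : finite_family g a ->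
  finite_family g b -> \sum_(s \in X) (a s + b s) =
  \sum_(s \in X) a s + \sum_(s \in X) b s.
Proof.
(* The union of the two supports is a finite index set that serves all three sums. *)
move=> fa fb; pose Y := (X `&` a @^-1` [set~ 0]) `|` (X `&` b @^-1` [set~ 0]).
have fY : finite_set Y by rewrite finite_setU.
have YX : Y `<=` X by move=> s [] [].
have Ya : X `\` Y `<=` a @^-1` [set 0].
  by move=> s [Xs Ys]; apply: contrapT => as0; apply: Ys; left.
have Yb : X `\` Y `<=` b @^-1` [set 0].
  by move=> s [Xs Ys]; apply: contrapT => bs0; apply: Ys; right.
rewrite -(fsbig_widen _ _ _ YX Ya) -(fsbig_widen _ _ _ YX Yb) -(fsbig_split _ _ _ fY).
apply/esym/fsbig_widen => // s XYs /=.
by rewrite (Ya _ XYs) (Yb _ XYs) addr0.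
Qed.

Lemma finite_family_single s x :
  finite_family g (fun t => if t == s then x else 0).
Proof.
apply: (@sub_finite_set _ _ [set s]); last exact: finite_set1.
by move=> t [_] /=; case: eqP.
Qed.

Lemma fsum_single s x : X s ->
  \sum_(t \in X) (if t == s then x else 0) = x.
Proof.
move=> Xs; rewrite (@fsum_seqE _ _ _ _ _ [:: s]) //.
- by rewrite big_seq1 eqxx.
- by move=> t; rewrite inE => /eqP ->.
- by move=> t _; rewrite inE => /negPf ->.
Qed.

End FiniteFamilies.

(** * The graph of the induced map as an additive relation *)

Section InducedGraph.
Implicit Types (g h : max_group_image S).
Local Notation graph := (induced_graph th).
Local Notation D := (induced_dom th).

Lemma principalP s x : principal (E s) x <-> E s * x = x.
Proof. by split=> [/principal_idE|<-] //; exists x. Qed.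

Lemma action_fun_eq s x y : th s x = Some y -> action_fun th s x = y.
Proof. by rewrite /action_fun => ->. Qed.

Lemma induced_graph0 g : graph g 0 0.
Proof.
exists (fun=> 0); first split=> [s _|].
- by exists 0; rewrite mulr0.
- exact: finite_family0.
- by split; apply/esym/fsbig1 => // s _; rewrite action_fun0.
Qed.

Lemma induced_graphD g x y x' y' :
  graph g x y -> graph g x' y' -> graph g (x + x') (y + y').
Proof.
move=> [a [pa fa] [-> ->]] [b [pb fb] [-> ->]].
have ff c : finite_family g c ->
    finite_family g (fun s => action_fun th s (c s)).
  by apply: sub_finite_family => s _ ->; rewrite action_fun0.
exists (fun s => a s + b s); first split=> [s gs|].
- by apply/principalP; rewrite mulrDr !principal_idE //; [exact: pb|exact: pa].
- exact: finite_familyD.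
- split; rewrite -fsum_familyD //; try exact: ff.
  apply: eq_fsbigr => s; rewrite inE => gs.
  by rewrite action_funD //; [exact: pa|exact: pb].
Qed.

Lemma induced_graph_action g s x y :
  sigma_class g s -> th s x = Some y -> graph g x y.
Proof.
(* The witness is the family concentrated at [s]. *)
move=> gs sx; exists (fun t => if t == s then x else 0); first split=> [t _|].
- case: eqP => [->|_]; last by exists 0; rewrite mulr0.
  by apply/principalP/action_domP; exists y.
- exact: finite_family_single.
- split; first by rewrite fsum_single.
  rewrite -[LHS](fsum_single y gs); apply: eq_fsbigr => t _.
  by case: eqP => [->|_]; rewrite ?action_fun0 // (action_fun_eq sx).
Qed.

(** Each pair of the graph is a finite sum of pairs $(a_s,\theta_s(a_s))$; additive properties
    therefore need checking only on a single $\theta_s$. *)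
Lemma induced_graph_ind g (P : A -> A -> Prop) :
  P 0 0 ->
  (forall x y x' y', P x y -> P x' y' -> P (x + x') (y + y')) ->
  (forall s x y, sigma_class g s -> th s x = Some y -> P x y) ->
  forall x y, graph g x y -> P x y.
Proof.
move=> P0 PD Ps x y [a [pa fa] [-> ->]].
apply: fsum_family_ind => // [s gs ->|s gs].
  by rewrite action_fun0.
by apply: (Ps s) => //; apply: action_funE; exact: pa.
Qed.

Lemma induced_graphV g x y : graph g x y -> graph g^-1%g y x.
Proof.
apply: (@induced_graph_ind g (fun x y => graph g^-1%g y x)).
- exact: induced_graph0.
- by move=> *; exact: induced_graphD.
- move=> s {}x {}y gs sx; apply: (induced_graph_action (sigma_classV gs)).
  exact: actionV.
Qed.

Lemma induced_graphVK g x y : graph g^-1%g x y -> graph g y x.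
Proof. by move=> /induced_graphV; rewrite invgK. Qed.

(** * The ideals $\mathcal D_g$ and their local units *)

Lemma induced_domP g x : D g x <-> exists y, graph g y x.
Proof.
split=> [[a [pa fa ->]]|[y [a [pa fa] [_ ->]]]].
(* Each summand in $1_sA$ is pulled back along $\theta_{s^{-1}}$, which keeps the support finite. *)
- pose b s := action_fun th s^-1%g (a s).
  have sb s : sigma_class g s -> th s (b s) = Some (a s).
    move=> gs; apply: actionVK; apply: action_funE.
    by rewrite invgK; exact: pa.
  exists (\sum_(s \in sigma_class g) b s); exists b; split=> //.
  + by move=> s gs; apply/principalP/action_domP; exists (a s); exact: sb.
  + by apply: sub_finite_family fa => s _; rewrite /b => ->; rewrite action_fun0.
  + by apply: eq_fsbigr => s; rewrite inE => /sb /action_fun_eq.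
- exists (fun s => action_fun th s (a s)); split=> //.
  + move=> s gs; apply/principalP/(@action_ranE _ (a s)).
    by apply: action_funE; exact: pa.
  + by apply: sub_finite_family fa => s _ ->; rewrite action_fun0.
Qed.

Lemma induced_domVP g x : D g^-1%g x <-> exists y, graph g x y.
Proof.
rewrite induced_domP; split=> -[y gxy]; exists y.
  exact: induced_graphVK.
exact: induced_graphV.
Qed.

Lemma induced_dom_ind g (P : A -> Prop) :
  P 0 -> (forall x y, P x -> P y -> P (x + y)) ->
  (forall s x, sigma_class g s -> E s * x = x -> P x) ->
  forall x, D g x -> P x.
Proof.
move=> P0 PD Ps x /induced_domP[y].
apply: (@induced_graph_ind g (fun _ => P)) => // [x1 x2 y1 y2|s {}y {}x gs sy].
  exact: PD.
by apply: Ps gs _; exact: action_ranE sy.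
Qed.

Lemma induced_dom0 g : D g 0.
Proof. by apply/induced_domP; exists 0; exact: induced_graph0. Qed.

Lemma induced_domD g x y : D g x -> D g y -> D g (x + y).
Proof.
move=> /induced_domP[x' gx] /induced_domP[y' gy]; apply/induced_domP.
by exists (x' + y'); exact: induced_graphD.
Qed.

Lemma induced_dom_unit g s x : sigma_class g s -> E s * x = x -> D g x.
Proof.
move=> gs ex; have [y sx] : exists y, th s^-1%g x = Some y.
  by apply/action_domP; rewrite invgK.
by apply/induced_domP; exists y; apply: induced_graph_action gs (actionVK sx).
Qed.

Lemma induced_domZ g (k : K) x : D g x -> D g (pzscale k x).
Proof.
move: x; apply: induced_dom_ind => [|x y|s x gs ex].
- by rewrite pzscaler0; exact: induced_dom0.
- by rewrite pzscalerDr; exact: induced_domD.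
- by apply: induced_dom_unit gs _; rewrite -pzscalerAr ex.
Qed.

Lemma induced_domMr g x z : D g x -> D g (x * z).
Proof.
move: x; apply: induced_dom_ind => [|x y|s x gs ex].
- by rewrite mul0r; exact: induced_dom0.
- by rewrite mulrDl; exact: induced_domD.
- by apply: induced_dom_unit gs _; rewrite mulrA ex.
Qed.

Lemma induced_domMl g x z : D g x -> D g (z * x).
Proof.
move: x; apply: induced_dom_ind => [|x y|s x gs ex].
- by rewrite mulr0; exact: induced_dom0.
- by rewrite mulrDr; exact: induced_domD.
- by apply: induced_dom_unit gs _; rewrite mulrA action_unit_central -mulrA ex.
Qed.

Lemma induced_dom_ideal g : is_ideal (D g).
Proof.
split; [exact: induced_dom0|exact: induced_domD|exact: induced_domZ|].
by move=> z x gx; split; [exact: induced_domMl|exact: induced_domMr].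
Qed.

Lemma induced_dom_local_unit g x : D g x ->
  exists e, [/\ D g e, forall y, e * y = y * e & e * x = x].
Proof.
move: x; apply: induced_dom_ind => [|x y|s x gs ex].
- by exists 0; split=> [|y|]; rewrite ?mul0r ?mulr0 //; exact: induced_dom0.
- move=> [e [ge ce ex]] [f [gf cf fy]].
  (* This is the join $e+f-fe$: its complement $(1-f)(1-e)$ kills $x$ and, by centrality, also
     $y$. *)
  exists (e + f * (1 - e)); split=> [|z|].
  + by apply: induced_domD => //; exact: induced_domMr.
  + apply/commr_sym/commrD; first exact/commr_sym/ce.
    apply: commrM; first exact/commr_sym/cf.
    by apply: commrB; [exact: commr1|exact/commr_sym/ce].
  + rewrite mulrDr; congr (_ + _).
      by rewrite mulrDl ex -mulrA mulrBl mul1r ex subrr mulr0 addr0.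
    by rewrite cf mulrDl -mulrA fy mulrBl mul1r addrC subrK.
- exists (E s); split=> [|y|//]; last exact: action_unit_central.
  by apply: induced_dom_unit gs _; exact: action_unit_idem.
Qed.

(* Local units give [D_g :&: D_h = D_g * D_h], which is spanned by the ideals
   1_s 1_t A. *)
Lemma induced_domI_ind g h (P : A -> Prop) :
  P 0 -> (forall x y, P x -> P y -> P (x + y)) ->
  (forall s t x, sigma_class g s -> sigma_class h t ->
     E s * x = x -> E t * x = x -> P x) ->
  forall x, D g x -> D h x -> P x.
Proof.
move=> P0 PD Pst x /induced_dom_local_unit[e [ge _ ex]] hx.
(* Once $x$ is written as $ex$, the product is additive in $e\in\mathcal D_g$ and in $x\in\mathcal
   D_h$, so induction runs on each factor in turn. *)
rewrite -ex; move: e ge {ex}; apply: induced_dom_ind => [|e f|s e gs ee].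
- by rewrite mul0r.
- by rewrite mulrDl; exact: PD.
move: x hx; apply: induced_dom_ind => [|x y|t x ht tx].
- by rewrite mulr0.
- by rewrite mulrDr; exact: PD.
apply: Pst gs ht _ _; first by rewrite mulrA ee.
by rewrite mulrA action_unit_central -mulrA tx.
Qed.

(** * Scalars and products *)

Lemma induced_graphZ g (k : K) x y :
  graph g x y -> graph g (pzscale k x) (pzscale k y).
Proof.
apply: (@induced_graph_ind g
    (fun x y => graph g (pzscale k x) (pzscale k y))).
- by rewrite pzscaler0; exact: induced_graph0.
- by move=> *; rewrite !pzscalerDr; exact: induced_graphD.
- move=> s {}x {}y gs sx; apply: (induced_graph_action gs).
  exact: action_scale.
Qed.

(** By biadditivity, two inductions reduce to generators coming from possibly different $s,t\in g$,
    where [action_mul_cong] applies. *)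
Lemma induced_graphM g x y x' y' :
  graph g x y -> graph g x' y' -> graph g (x * x') (y * y').
Proof.
move=> + gx'y'; move: x y; apply: induced_graph_ind.
- by rewrite !mul0r; exact: induced_graph0.
- by move=> *; rewrite !mulrDl; exact: induced_graphD.
- move=> s x y gs sx; move: x' y' gx'y'; apply: induced_graph_ind.
  + by rewrite !mulr0; exact: induced_graph0.
  + by move=> *; rewrite !mulrDr; exact: induced_graphD.
  + move=> t x' y' gt tx'; apply: (induced_graph_action gs).
    apply: action_mul_cong sx tx'; apply: sigma_class_cong; [exact: gs|by []|..].
      exact: sigma_classV gs.
    exact: sigma_classV gt.
Qed.

(** * Injectivity and composition of the graphs *)

Lemma induced_graph_inj g x y z : graph g x z -> graph g y z -> x = y.
Proof.
by move=> /induced_graphV gx /induced_graphV; exact: induced_graph_fun gx.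
Qed.

Lemma induced_map_graph g x y : induced_map th g x = Some y <-> graph g x y.
Proof.
split=> [|[a ga [-> ->]]]; last exact: induced_mapE.
rewrite /induced_map; case: pselect => // ex [<-].
exact: (svalP (cid ex)).
Qed.

(** On $1_sA\cap 1_tA$ with $s\in g^{-1}$ and $t\in h$, both $\theta_{s^{-1}}$ and $\theta_{t^{-1}}$
    are defined, and $\theta_{s^{-1}}\theta_t$ is covered by $s^{-1}t\in gh$. Sums of such elements
    exhaust the intersection. *)
Lemma induced_graph_factor g h z : D g^-1%g z -> D h z ->
  exists x y, [/\ graph h x z, graph g z y & graph (g * h)%g x y].
Proof.
move: z; apply: induced_domI_ind => [|z z'|s t z gs ht sz tz].
- by exists 0, 0; split; exact: induced_graph0.
- move=> [x [y [hx gz ghx]]] [x' [y' [hx' gz' ghx']]].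
  by exists (x + x'), (y + y'); split; exact: induced_graphD.
have gs' : sigma_class g s^-1%g by rewrite -(invgK g); exact: sigma_classV.
have [y sy] : exists y, th s^-1%g z = Some y.
  by apply/action_domP; rewrite invgK.
have [x tx] : exists x, th t^-1%g z = Some x.
  by apply/action_domP; rewrite invgK.
exists x, y; split.
- exact: induced_graph_action ht (actionVK tx).
- exact: induced_graph_action gs' sy.
- apply: induced_graph_action (sigma_classM gs' ht) _.
  exact: actionM (actionVK tx) sy.
Qed.

(** The factorization through $y$ yields some endpoints; injectivity at $h$ and functionality at $g$
    force them to be $x$ and $z$. *)
Lemma induced_graph_comp g h x y z :
  graph h x y -> graph g y z -> graph (g * h)%g x z.
Proof.
move=> hxy gyz; have [||x' [z' [hx' gz' ghx']]] := @induced_graph_factor g h y.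
- by apply/induced_domVP; exists z.
- by apply/induced_domP; exists x.
by rewrite (induced_graph_inj hxy hx') (induced_graph_fun th_compat gyz gz').
Qed.

Lemma induced_graph_dom g h x y : graph g x y -> D h x -> D (g * h)%g y.
Proof.
move=> gxy /induced_domP[z hzx]; apply/induced_domP; exists z.
exact: induced_graph_comp hzx gxy.
Qed.

(** * The axioms of a partial action *)

Lemma induced_map_iso g : is_alg_iso (D g^-1%g) (D g) (induced_map th g).
Proof.
split.
- split; apply/seteqP; split=> x.
  + by move=> [y /induced_map_graph gxy]; apply/induced_domVP; exists y.
  + by move=> /induced_domVP[y gxy]; exists y; apply/induced_map_graph.
  + by move=> [y /induced_map_graph gyx]; apply/induced_domP; exists y.
  + by move=> /induced_domP[y gyx]; exists y; apply/induced_map_graph.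
- move=> x y z /induced_map_graph gx /induced_map_graph.
  exact: induced_graph_inj gx.
- move=> x y x' y' /induced_map_graph gx /induced_map_graph gy.
  by apply/induced_map_graph; exact: induced_graphD.
- move=> k x x' /induced_map_graph gx.
  by apply/induced_map_graph; exact: induced_graphZ.
- move=> x y x' y' /induced_map_graph gx /induced_map_graph gy.
  by apply/induced_map_graph; exact: induced_graphM.
Qed.

Lemma induced_graph1 x : graph 1%g x x.
Proof. by apply: (@induced_graph_action _ 1%g) => //; rewrite action_id. Qed.

End InducedGraph.
End Action.

Theorem proposition2p6 (K : comPzRingType) (S : inverseMonoidType)
    (A : pzAlgType K) (th : unital_action A S) (th_compat : compatible th) :
  is_partial_action (G := max_group_image S) (induced_dom th) (induced_map th).
Proof.
have mapP := induced_map_graph th_compat; split=> [g|g||g h|g h x [/= hx ghx]].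
- exact: induced_dom_ideal.
- exact: induced_map_iso.
- split=> [|x]; last exact/mapP/induced_graph1.
  apply/seteqP; split=> // x _; apply/induced_domP.
  by exists x; exact: induced_graph1.
- apply/seteqP; split=> y.
    move=> [x [_ hx] /mapP gxy].
    split; last exact: (induced_graph_dom th_compat gxy).
    by apply/induced_domP; exists x.
  move=> [/induced_domP[x gxy] ghy].
  exists x; last exact/mapP.
  split; first by apply/induced_domVP; exists y.
  (* As $h=g^{-1}(gh)$, the inverse graph carries $y\in\mathcal D_{gh}$ back to $x\in\mathcal
     D_h$. *)
  rewrite -(mulKg g h); apply: (induced_graph_dom th_compat) ghy.
  exact: induced_graphV.
- have /induced_domVP[y hxy] := hx.
  have /induced_domVP[z gyz] : induced_dom th g^-1%g y.
    (* Here $g^{-1}=h(h^{-1}g^{-1})$, and $x\in\mathcal D_{h^{-1}g^{-1}}$ is sent to $y$ at $h$. *)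
    by rewrite -(mulVKg h g^-1%g); exact: (induced_graph_dom th_compat hxy).
  have /mapP-> // := hxy.
  have /mapP-> // := induced_graph_comp th_compat hxy gyz.
  by rewrite /=; apply/mapP.
Qed.
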